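(* Let $G=(V,E)$ be a finite undirected Ore graph with $n=|V|$ nodes, i.e. for any two distinct nodes $u,v$ that are not adjacent, $|\Gamma(u)|+|\Gamma(v)|\ge n$, and let $t(u)=2$ for every $u\in V$. Then every execution of the algorithm MTS on input $(G,t)$ returns a minimum-size target set for $G$ with thresholds $t$.
   Context: Graphs are finite, without loops; $\Gamma(v)$ denotes the neighborhood of $v$ in an undirected graph. An undirected graph is treated as the bidirected digraph in which each edge $\{u,v\}$ is replaced by the two arcs $(u,v),(v,u)$. For a digraph $G=(V,E)$ and $v\in V$, $\Gamma^{in}(v)=\{u:(u,v)\in E\}$ and $\Gamma^{out}(v)=\{u:(v,u)\in E\}$. Given thresholds $t:V\to\mathbb{N}=\{0,1,2,\dots\}$ and $S\subseteq V$, the activation process starting at $S$ is $A_0=S$ and $A_\ell=A_{\ell-1}\cup\{u\in V: |\Gamma^{in}(u)\cap A_{\ell-1}|\ge t(u)\}$ for $\ell\ge1$. $S$ is a target set for $(G,t)$ if $A_\lambda=V$ for some $\lambda\ge0$. Algorithm MTS on input $(G,t)$: set $S=\emptyset$, $L=\emptyset$, $U=V$, and for each $v\in V$ set $k(v)=t(v)$, $\delta(v)=|\Gamma^{in}(v)|$. While $U\neq\emptyset$, perform one iteration as follows. Case 1: if some $v\in U$ has $k(v)=0$, select such a $v$; for each $u\in\Gamma^{out}(v)\cap U$ set $k(u)=\max(k(u)-1,0)$ and, if $v\notin L$, set $\delta(u)=\delta(u)-1$; then set $U=U\setminus\{v\}$. Case 2: otherwise, if some $v\in U\setminus L$ has $\delta(v)<k(v)$,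 select such a $v$; set $S=S\cup\{v\}$; for each $u\in\Gamma^{out}(v)\cap U$ set $k(u)=k(u)-1$ and $\delta(u)=\delta(u)-1$; then set $U=U\setminus\{v\}$. Case 3: otherwise, select $v\in U\setminus L$ maximizing $\frac{k(u)}{\delta(u)(\delta(u)+1)}$ over $u\in U\setminus L$; for each $u\in\Gamma^{out}(v)\cap U$ set $\delta(u)=\delta(u)-1$; set $L=L\cup\{v\}$. When $U=\emptyset$, return $S$. Whenever several nodes qualify in a case, one of them is chosen arbitrarily. *)

(* Defs.v *)
From Stdlib Require Import Relation_Operators.
From mathcomp Require Import all_boot all_order all_algebra.

Set Implicit Arguments.
Unset Strict Implicit.
Unset Printing Implicit Defensive.

Import Order.TTheory GRing.Theory Num.Theory.

(* A digraph on [V] is its arc relation: [e u v] means that (u, v) is an arc.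
   An undirected loopless graph is a symmetric irreflexive [e], which is
   literally the associated bidirected digraph. *)
Section Defs.
Variable V : finType.
Implicit Types (e : rel V) (t : V -> nat) (S T : {set V}) (u v : V).

Definition in_nbr e v : {set V} := [set u | e u v].
Definition out_nbr e v : {set V} := [set u | e v u].

(* Neighborhood in an undirected graph (symmetric [e]). *)
Definition nbr e v : {set V} := [set u | e v u].

Definition ore_graph e : Prop :=
  forall u v, u != v -> ~~ e u v -> #|V| <= #|nbr e u| + #|nbr e v|.

Fixpoint activated e t S (l : nat) : {set V} :=
  if l is l'.+1 then
    let A := activated e t S l' in
    A :|: [set u | t u <= #|in_nbr e u :&: A|]
  else S.

Definition target_set e t S : Prop := exists l, activated e t S l = [set: V].

Definition min_target_set e t S : Prop :=
  target_set e t S /\ forall T, target_set e t T -> #|S| <= #|T|.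

(* [st_k] and [st_delta] are nat-valued with truncated predecessor: in Case 1
   this is max(k(u)-1, 0); elsewhere the truncation never takes effect, since
   in Case 2 every node of U has k > 0, and each in-neighbor of u causes
   delta(u) to be decremented at most once. *)
Record mts_state : Type := MtsState {
  st_S : {set V};
  st_L : {set V};
  st_U : {set V};
  st_k : V -> nat;
  st_delta : V -> nat
}.

Definition mts_init e t : mts_state :=
  {| st_S := set0; st_L := set0; st_U := [set: V];
     st_k := t; st_delta := fun v => #|in_nbr e v| |}.

Definition case1_node (s : mts_state) v : bool :=
  (v \in st_U s) && (st_k s v == 0).

Definition case2_node (s : mts_state) v : bool :=
  (v \in st_U s :\: st_L s) && (st_delta s v < st_k s v).

(* Only compared when Cases 1 and 2 do not apply, so that the nodes of U \ L
   satisfy delta >= k >= 1 and the denominator is nonzero. *)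
Definition mts_ratio (s : mts_state) v : rat :=
  ((st_k s v)%:R / (st_delta s v * (st_delta s v).+1)%:R)%R.

Definition case3_node (s : mts_state) v : Prop :=
  v \in st_U s :\: st_L s /\
  forall u, u \in st_U s :\: st_L s -> (mts_ratio s u <= mts_ratio s v)%R.

Definition dec_on (A : {set V}) (f : V -> nat) : V -> nat :=
  fun u => if u \in A then (f u).-1 else f u.

(* One iteration of the loop; no step leaves a state with U empty. *)
Inductive mts_step e (s : mts_state) : mts_state -> Prop :=
| MtsCase1 v of case1_node s v :
    let N := out_nbr e v :&: st_U s in
    mts_step e s
      {| st_S := st_S s; st_L := st_L s; st_U := st_U s :\ v;
         st_k := dec_on N (st_k s);
         st_delta := if v \in st_L s then st_delta s
                     else dec_on N (st_delta s) |}
| MtsCase2 v of (forall w, ~~ case1_node s w) & case2_node s v :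
    let N := out_nbr e v :&: st_U s in
    mts_step e s
      {| st_S := v |: st_S s; st_L := st_L s; st_U := st_U s :\ v;
         st_k := dec_on N (st_k s); st_delta := dec_on N (st_delta s) |}
| MtsCase3 v of (forall w, ~~ case1_node s w) & (forall w, ~~ case2_node s w)
    & case3_node s v :
    let N := out_nbr e v :&: st_U s in
    mts_step e s
      {| st_S := st_S s; st_L := v |: st_L s; st_U := st_U s;
         st_k := st_k s; st_delta := dec_on N (st_delta s) |}.

(* Every execution, whatever the choices, returns a set satisfying [Q]: no
   execution is infinite, and one that cannot be continued has reached U empty
   (it is not stuck for lack of an eligible node) with output in [Q]. *)
Definition mts_always_returns e t (Q : {set V} -> Prop) : Prop :=
  (~ exists f : nat -> mts_state,
       f 0 = mts_init e t /\ forall i, mts_step e (f i) (f i.+1)) /\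
  (forall s, clos_refl_trans mts_state (mts_step e) (mts_init e t) s ->
     (forall s', ~ mts_step e s s') ->
     st_U s = set0 /\ Q (st_S s)).

End Defs.

(* Main.v *)
Require Import Defs.
From Stdlib Require Import Relation_Operators.
From mathcomp Require Import all_boot all_order all_algebra zify.

Set Implicit Arguments.
Unset Strict Implicit.
Unset Printing Implicit Defensive.

Import Order.TTheory GRing.Theory Num.Theory.

(** With all thresholds 2, call a set closed if every outside vertex has at most
one neighbour in it; a set is a target set iff the only closed set containing
it is the whole vertex set. It suffices that the first two vertices put in the
output lie in no proper closed set: a third one would be selected only while
the activated vertices form a proper closed set.

Until the first selection, MTS deletes vertices of minimum degree from a set
[H]. Let [A] be a proper closed set with at least 3 vertices. By the Ore
condition each vertex of [A] has degree at least [#|A|]; so as long as only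
vertices of [A] are deleted and two of them remain, the remaining ones have
degree at least 2 in [H] and none of them is selected. Counting the edges
leaving [A], if a vertex outside [A] is ever deleted, then [A] and its
complement are two cliques of the same size joined by a perfect matching, and
a matching edge always survives in [H]. In either case [A] cannot contain both
selected vertices [u] and [w]: if they are not adjacent, [A] is not a clique;
if they are, the ratio rule of Case 3 forces [u w] to be an isolated edge of
[H], leaving no surviving matching edge. *)

(** * Degrees into a set, closed sets and cliques *)

Section ClosedSets.
Variables (V : finType) (e : rel V).
Hypotheses (e_sym : symmetric e) (e_irr : irreflexive e) (e_ore : ore_graph e).
Implicit Types (A B H : {set V}) (u v w x y z : V).

Definition dg x A := #|nbr e x :&: A|.
Definition closed A := forall x, x \notin A -> dg x A <= 1.
Definition clique A := {in A &, forall x y, x != y -> e x y}.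

Lemma dg_sum x A : dg x A = \sum_(z in A) e x z.
Proof.
rewrite /dg -sum1_card big_mkcond /= [RHS]big_mkcond /=.
by apply: eq_bigr => z _; rewrite !inE; case: (e x z); case: (z \in A).
Qed.

Lemma dg_set0 x : dg x set0 = 0.
Proof. by rewrite /dg setI0 cards0. Qed.

Lemma dg_setT x : dg x setT = #|nbr e x|.
Proof. by rewrite /dg setIT. Qed.

Lemma dg_split x H A : dg x H = dg x (H :&: A) + dg x (H :\: A).
Proof. by rewrite /dg -(cardsID A (nbr e x :&: H)) setIA setIDA. Qed.

Lemma dg_split_deg x A : #|nbr e x| = dg x A + dg x (~: A).
Proof. by rewrite -dg_setT (dg_split x setT A) setTI setTD. Qed.

Lemma dgD1 x v H : v \in H -> dg x H = e x v + dg x (H :\ v).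
Proof. by move=> vH; rewrite !dg_sum (big_setD1 v). Qed.

Lemma dgS x A B : A \subset B -> dg x A <= dg x B.
Proof. by move=> sAB; apply/subset_leq_card/setIS. Qed.

Lemma dg_le x A : dg x A <= #|A|.
Proof. exact/subset_leq_card/subsetIr. Qed.

Lemma dg_lt x A : x \in A -> dg x A < #|A|.
Proof.
move=> xA; rewrite (dgD1 x xA) e_irr add0n (cardsD1 x) xA add1n ltnS.
exact: dg_le.
Qed.

Lemma dg_gt0P x A : reflect (exists2 y, y \in A & e x y) (0 < dg x A).
Proof.
apply: (iffP card_gt0P) => [[y]|[y yA xy]].
  by rewrite !inE => /andP[xy yA]; exists y.
by exists y; rewrite !inE xy.
Qed.

Lemma dg_exchange A B : \sum_(y in A) dg y B = \sum_(z in B) dg z A.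
Proof.
under eq_bigr do rewrite dg_sum.
rewrite exchange_big /=; apply: eq_bigr => z _; rewrite dg_sum.
by apply: eq_bigr => y _; rewrite e_sym.
Qed.

Lemma clique_of_dg A : (forall x, x \in A -> #|A| <= (dg x A).+1) -> clique A.
Proof.
move=> h x y xA yA nxy; have := h x xA; rewrite (dgD1 x yA).
have := dg_lt (A := A :\ y) (x := x); rewrite !inE nxy xA => /(_ isT).
by rewrite (cardsD1 y A) yA; case: (e x y) => //; lia.
Qed.

Lemma clique_dg A H x : clique A -> H \subset A -> x \in H -> (dg x H).+1 = #|H|.
Proof.
move=> cA sHA xH; rewrite (dgD1 x xH) e_irr add0n (cardsD1 x H) xH add1n.
congr _.+1; rewrite /dg; apply/eq_card => y; rewrite !inE.
case: (eqVneq y x) => [->|nyx]; rewrite ?andbF //=.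
case yH: (y \in H); rewrite ?andbF // cA // ?(subsetP sHA) // 1?eq_sym //.
Qed.

Lemma ore_dg A y z : y != z -> ~~ e y z ->
  #|A| + #|~: A| <= dg y A + dg y (~: A) + (dg z A + dg z (~: A)).
Proof. by move=> nyz eyz; rewrite -!dg_split_deg cardsC; apply: e_ore. Qed.

(** * Edges leaving a fixed proper closed set *)

Section FixedClosed.
Variable A : {set V}.
Hypotheses (clA : closed A) (A_proper : A != setT).

Let exC : exists z, z \notin A.
Proof.
move: A_proper; rewrite -subTset => /subsetPn[z _ zA]; by exists z.
Qed.

(** Otherwise [y] is adjacent to no outside vertex [z], and their degrees, at most [#|A| - 1] and
    [#|~: A|], break the Ore condition. *)
Lemma cross_gt0 y : y \in A -> 0 < dg y (~: A).
Proof.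
move=> yA; rewrite lt0n; apply/eqP => d0; have [z zA] := exC.
have nyz : y != z by apply: contraNneq zA => <-.
have nez : ~~ e y z.
  apply/negP => yz; suff: 0 < dg y (~: A) by rewrite d0.
  by apply/dg_gt0P; exists z; rewrite ?inE.
have := ore_dg A nyz nez; have := dg_lt yA; have := clA zA.
have := @dg_lt z (~: A); rewrite inE zA => /(_ isT); lia.
Qed.

(* A vertex adjacent to all of [~: A] would leave no neighbour there to the
   other vertices of [A]. *)
Lemma deg_ge_card y : 1 < #|A| -> y \in A -> #|A| <= #|nbr e y|.
Proof.
move=> A2 yA; have [y' /setD1P[ny' y'A]] : exists y', y' \in A :\ y.
  by apply/card_gt0P; move: A2; rewrite (cardsD1 y) yA.
have /dg_gt0P[z] := cross_gt0 y'A; rewrite inE => zA y'z.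
have nyz : y != z by apply: contraNneq zA => <-.
have nez : ~~ e y z.
  apply/negP => yz; have := clA zA; rewrite (dgD1 z yA) (@dgD1 z y') ?inE ?ny' //.
  by rewrite ![e z _]e_sym yz y'z.
have := ore_dg A nyz nez; rewrite -(dg_split_deg y); have := clA zA.
have := @dg_lt z (~: A); rewrite inE zA => /(_ isT); lia.
Qed.

Lemma cross_sum_le : \sum_(y in A) dg y (~: A) <= #|~: A|.
Proof.
rewrite dg_exchange -sum1_card; apply: leq_sum => z; rewrite inE; exact: clA.
Qed.

Lemma cross_sum_sub B : B \subset A ->
  \sum_(y in B) dg y (~: A) + #|A| <= #|~: A| + #|B|.
Proof.
move=> sBA; have := cross_sum_le; rewrite (big_setID B) /= (setIidPr sBA).
have : #|A :\: B| <= \sum_(y in A :\: B) dg y (~: A).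
  rewrite -sum1_card; apply: leq_sum => y /setDP[yA _]; exact: cross_gt0.
have := cardsID B A; rewrite (setIidPr sBA); lia.
Qed.

(** Counting the edges leaving [A] gives each vertex of [A] a single outside neighbour, so the
    degree bounds behind both cliques are tight. *)
Lemma two_cliques : 1 < #|A| -> #|~: A| <= #|A| -> clique A /\ clique (~: A).
Proof.
move=> A2 leCA.
have c1 y : y \in A -> dg y (~: A) <= 1.
  move=> yA; have := @cross_sum_sub [set y]; rewrite sub1set yA => /(_ isT).
  by rewrite big_set1 cards1; lia.
split; apply: clique_of_dg => x xA.
  have := deg_ge_card A2 xA; rewrite (dg_split_deg x A); have := c1 x xA; lia.
rewrite inE in xA.
have [y yA nez] : exists2 y, y \in A & ~~ e y x.
  apply/exists_inP; rewrite -negb_forall_in; apply/negP => /forall_inP h.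
  have := clA xA; rewrite dg_sum (eq_bigr (fun=> 1)) ?sum1_card; first lia.
  by move=> y yA; rewrite e_sym h.
have nyx : y != x by apply: contraNneq xA => <-.
have := ore_dg A nyx nez; have := c1 y yA; have := dg_lt yA; have := clA xA.
lia.
Qed.

(** A second outside vertex is not adjacent to [y], whose degree is at most [#|A|]; the Ore
    condition then joins it to all others in [~: A]. *)
Lemma cross1_clique y : y \in A -> dg y (~: A) = 1 ->
  forall z z', z \notin A -> z' \notin A -> e y z -> z' != z -> e z z'.
Proof.
move=> yA cy z z' zA z'A yz nz.
have nyz : y != z' by apply: contraNneq z'A => <-.
have nez : ~~ e y z'.
  apply/negP => yz'; move: cy; rewrite (@dgD1 y z) ?inE // (@dgD1 y z') ?inE ?nz ?z'A //.
  by rewrite yz yz'; lia.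
have := ore_dg A nyz nez; have := dg_lt yA; have := clA z'A; rewrite cy.
rewrite (@dgD1 z' z (~: A)) ?inE // [e z' z]e_sym; case: (e z z') => //.
have := @dg_lt z' (~: A :\ z); rewrite !inE nz z'A => /(_ isT).
have := cardsD1 z (~: A); rewrite !inE zA /=; lia.
Qed.

(* The first vertex outside [A] deleted by a minimum-degree deletion order is
   a vertex of minimum degree in some [H] containing [~: A]. *)
Lemma min_deg_outside H z : 2 < #|A| -> ~: A \subset H -> 1 < #|A :&: H| ->
  z \notin A -> {in A :&: H, forall y, dg z H <= dg y H} -> #|~: A| <= #|A|.
Proof.
move=> A3 sCH B2 zA zmin.
pose B := A :&: H; pose m := #|~: A|; pose c y := dg y (~: A).
have sBA : B \subset A by apply: subsetIl.
have HA : H :\: A = ~: A.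
  by apply/setP => x; rewrite !inE; case xA: (x \in A) => //=;
     apply: (subsetP sCH); rewrite inE xA.
have dgH x : dg x H = dg x B + c x by rewrite (dg_split x H A) HA setIC.
have leBA : #|B| <= #|A| by apply: subset_leq_card.
(* The second bound is the Ore condition; the first eliminates [c z] from it by the minimality of
   [dg z H]. *)
have nbrz y : y \in B -> ~~ e z y -> m + 2 + dg z B <= 2 * c y + #|B| + dg z A
    /\ m + 1 <= c y + c z + dg z A.
  move=> yB nzy; have yA := subsetP sBA y yB.
  have nyz : y != z by apply: contraNneq zA => <-.
  have := @ore_dg A y z nyz; rewrite e_sym => /(_ nzy).
  have := dg_lt yA; have := dg_lt yB; have := zmin y yB; rewrite !dgH /m /c; lia.
have sumB := cross_sum_sub sBA; rewrite -/m in sumB *.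
have dA := clA zA; have dBA : dg z B <= dg z A by apply: dgS.
pose C (X : {set V}) := \sum_(y in X) c y.
have C1 p (X : {set V}) : p \in X -> C X = c p + C (X :\ p) by move=> pX; rewrite /C (big_setD1 p).
rewrite -/(C B) in sumB.
(* Summed over [B], these bounds are to contradict [sumB], the cap on edges leaving [B]. The at most
   one neighbour of [z] in [A] is missing, outside [B], or in [B]. *)
rewrite leqNgt; apply/negP => ltAm.
have [dB0|dB1] := posnP (dg z B).
  have nzB y : y \in B -> ~~ e z y.
    by move=> yB; apply/negP => zy; move: dB0; rewrite (dgD1 z yB) zy.
  have sumH : #|B| * (m + 2) <= 2 * C B + #|B| * (#|B| + dg z A).
    rewrite -!sum_nat_const /C big_distrr -big_split; apply: leq_sum => y yB /=.
    have [] := nbrz y yB (nzB y yB); lia.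
  have [dA0|] := posnP (dg z A).
    have [|b3] := leqP #|B| 2; last by move: ltAm sumH sumB leBA; nia.
    by move: B2 ltAm sumH sumB; rewrite -/B dA0; nia.
  move=> dA1; have {dA dA1} dA1 : dg z A = 1 by lia.
  have /dg_gt0P[p pA zp] : 0 < dg z A by rewrite dA1.
  have pB : p \notin B by apply: contraTN zp => /nzB.
  have ltBA : #|B| < #|A|.
    by apply: proper_card; apply/properP; split => //; exists p.
  have [leB2|b3] := leqP #|B| 2; last by move: ltAm sumH sumB ltBA; nia.
  (* The counts leave only [#|A| = 3] and [C B = m - 1]. Then [z], the only outside neighbour of
     [p], is adjacent to the rest of [~: A], and minimality gives [c y >= m - 2] on [B], so
     [m <= 3]. *)
  have {leB2} b2 : #|B| = 2 by apply/eqP; rewrite eqn_leq leB2.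
  have cp1 : c p = 1.
    have := cross_sum_sub (B := p |: B); rewrite subUset sub1set pA sBA.
    move=> /(_ isT); rewrite big_setU1 //= cardsU1 pB b2 -/(C B) -/(c p) -/m.
    by have := cross_gt0 pA; rewrite -/(c p); move: sumH sumB; rewrite b2 dA1; lia.
  have cz : m <= (c z).+1.
    rewrite /c (_ : dg z (~: A) = #|~: A :\ z|).
      by rewrite /m (cardsD1 z) inE zA add1n.
    apply: eq_card => z'; rewrite !inE; case z'A: (z' \in A); rewrite ?andbF //.
    rewrite !andbT; case: eqVneq => [->|nz]; first by rewrite e_irr.
    by apply: (cross1_clique pA cp1); rewrite ?z'A // e_sym.
  have : #|B| * m <= C B + 2 * #|B|.
    rewrite [2 * _]mulnC -!sum_nat_const /C -big_split; apply: leq_sum => y yB /=.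
    have := zmin y yB; rewrite !dgH dB0; have := dg_lt yB; lia.
  by move: sumH sumB; rewrite b2 dA1; lia.
have /dg_gt0P[p pB zp] := dB1.
have [dA1 dB1'] : dg z A = 1 /\ dg z B = 1 by lia.
have cz : (c z).+2 <= #|B| + c p.
  have := zmin p pB; rewrite !dgH dB1'; have := dg_lt pB; lia.
have nzB y : y \in B :\ p -> ~~ e z y.
  move=> yB; apply/negP => zy; move: dB1'; rewrite (dgD1 z pB) (dgD1 z yB).
  by rewrite zp zy.
have cardB : #|B| = #|B :\ p|.+1 by rewrite (cardsD1 p) pB.
have sum1 : #|B :\ p| * (m + 2) <= 2 * C (B :\ p) + #|B :\ p| * #|B|.
  rewrite -!sum_nat_const /C big_distrr -big_split; apply: leq_sum => y yB /=.
  have [] := nbrz y (subsetP (subD1set _ _) y yB) (nzB y yB); lia.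
(* Minimality is now applied to [p] instead of [y], so that [c p], which [sumB] also counts,
   replaces one [c y]. *)
have sum2 : #|B :\ p| * (m + 2) <= C (B :\ p) + #|B :\ p| * (#|B| + c p).
  rewrite -!sum_nat_const /C -big_split; apply: leq_sum => y yB /=.
  have [] := nbrz y (subsetP (subD1set _ _) y yB) (nzB y yB); lia.
have := cross_gt0 (subsetP sBA p pB); rewrite -/(c p) => cp0.
move: sum1 sum2 sumB leBA B2; rewrite (C1 p B) // -/B cardB.
case: #|B :\ p| => [|[|[|k]]]; [lia|lia|lia|].
by move: (C (B :\ p)) (c p) cp0 => X q; nia.
Qed.

End FixedClosed.

(** * Invariants of minimum-degree deletion *)

Definition deletion_inv H := forall A, closed A -> 2 < #|A| -> A != setT ->
  1 < #|A :&: H| ->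
  ~: A \subset H \/
  [/\ clique A, clique (~: A) &
      exists y z, [/\ y \in A :&: H, z \in H :\: A & e y z]].

Lemma deletion_invT : deletion_inv setT.
Proof. by move=> A *; left; apply: subsetT. Qed.

(** The first deletion outside [A] forces the two cliques, and a remaining vertex of [A] not
    adjacent to [v] keeps its outside neighbour. Later, deleting an end of every remaining cross
    edge would contradict [vmin]. *)
Lemma deletion_inv_step H v : v \in H -> {in H, forall x, 1 < dg x H} ->
  {in H, forall x, dg v H <= dg x H} -> deletion_inv H -> deletion_inv (H :\ v).
Proof.
move=> vH dH vmin IH A clA A3 AT B2.
have sB : A :&: (H :\ v) \subset A :&: H by rewrite setIS ?subD1set.
have [sCH|[cA cC [y [z [yB zH yz]]]]] := IH A clA A3 AT (leq_trans B2 (subset_leq_card sB)).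
  have [vA|vA] := boolP (v \in A).
    left; apply/subsetP => x xA; rewrite !inE (subsetP sCH) // andbT.
    by apply: contraTneq xA => ->; rewrite inE vA.
  right; have leCA : #|~: A| <= #|A|.
    apply: (min_deg_outside clA AT A3 sCH _ vA).
      exact: leq_trans B2 (subset_leq_card sB).
    by move=> y /setIP[_ yH]; apply: vmin.
  have [cA cC] := two_cliques clA AT (ltnW A3) leCA; split=> //.
  have [y yB nyv] : exists2 y, y \in A :&: (H :\ v) & ~~ e y v.
    apply/exists_inP; rewrite -negb_forall_in; apply/negP => /forall_inP h.
    have := clA v vA; have := dgS v (subsetIl A (H :\ v)).
    rewrite [dg v (_ :&: _)]dg_sum (eq_bigr (fun=> 1)) ?sum1_card; first lia.
    by move=> y yB; rewrite e_sym h.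
  have yA : y \in A by case/setIP: yB.
  have /dg_gt0P[z] := cross_gt0 clA AT yA; rewrite inE => zA yz.
  exists y, z; split => //; rewrite !inE zA (subsetP sCH) ?inE //= andbT.
  by apply: contraNneq nyv => <-.
right; split=> //.
have [/exists_inP[y' y'B /exists_inP[z' z'B yz']]|no] := boolP
    [exists y' in A :&: (H :\ v), [exists z' in (H :\ v) :\: A, e y' z']].
  by exists y', z'.
have {}no y' z' : y' \in A :&: (H :\ v) -> z' \in (H :\ v) :\: A -> e y' z' = false.
  move=> y'B z'B; apply/negP => yz'; case/negP: no; apply/exists_inP; exists y' => //.
  by apply/exists_inP; exists z'.
have [/setIP[yA yH] /setDP[zH' zA]] := (yB, zH).
(* [v] lies on every remaining cross edge, so it beats in degree any other
   remaining vertex of its own clique. *)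
have [vA|vA] := boolP (v \in A).
  have [y' y'B] : exists y', y' \in A :&: (H :\ v).
    by apply/card_gt0P; apply: ltnW.
  have /setIP[y'A /setD1P[ny'v y'H]] := y'B.
  have {}yz : e v z.
    have [<-//|nyv] := eqVneq y v; move: yz; rewrite no // !inE ?nyv ?yA ?yH //.
    by rewrite zA zH' !andbT; apply: contraNneq zA => ->.
  apply: False_ind; have := vmin y' y'H; rewrite !(dg_split _ H A) setIC.
  have sAH : A :&: H \subset A by apply: subsetIl.
  have := clique_dg (x := v) cA sAH; rewrite !inE vA vH => /(_ isT).
  have := clique_dg (x := y') cA sAH; rewrite !inE y'A y'H => /(_ isT).
  suff [-> dv] : dg y' (H :\: A) = 0 /\ 0 < dg v (H :\: A).
    by move=> <- [->]; rewrite leq_add2l leqNgt dv.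
  split; last by apply/dg_gt0P; exists z.
  apply/eqP; rewrite -leqn0 leqNgt; apply/negP => /dg_gt0P[x xH y'x].
  suff: e y' x = false by rewrite y'x.
  apply: no => //; move: xH; rewrite !inE => /andP[xA ->]; rewrite xA !andbT /=.
  by apply: contraNneq xA => ->.
have {}yz : e v y.
  have [<-|nzv] := eqVneq z v; first by rewrite e_sym.
  move: yz; rewrite no // !inE ?nzv ?zA ?zH' ?yA ?yH // andbT.
  by apply: contraNneq vA => <-.
have vHA : v \in H :\: A by rewrite !inE vA vH.
(* [v] has degree at least 2 in [H] but at most one neighbour in [A]. *)
have [z' z'B] : exists z', z' \in (H :\: A) :\ v.
  apply/card_gt0P; have := dH v vH; rewrite (dg_split _ H A).
  have := clA v vA; have := dgS v (subsetIr H A).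
  have := dg_lt vHA; rewrite (cardsD1 v (H :\: A)) vHA; clear; lia.
have /setD1P[nz'v z'HA] := z'B; have /setDP[z'H z'A] := z'HA.
apply: False_ind; have := vmin z' z'H; rewrite !(dg_split _ H A).
have sHA : H :\: A \subset ~: A by rewrite setDE subsetIr.
have := clique_dg cC sHA vHA; have := clique_dg cC sHA z'HA.
suff [-> dv] : dg z' (H :&: A) = 0 /\ 0 < dg v (H :&: A).
  by move=> <- [->]; rewrite leq_add2r leqNgt dv.
split; last by apply/dg_gt0P; exists y; rewrite // inE yA yH.
apply/eqP; rewrite -leqn0 leqNgt; apply/negP => /dg_gt0P[x xH z'x].
suff: e x z' = false by rewrite e_sym z'x.
move: xH; rewrite inE => /andP[xH xA]; apply: no; last by rewrite !inE nz'v z'A.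
by rewrite !inE xA xH andbT /=; apply: contraNneq vA => <-.
Qed.

(** After a deletion, the deleted vertex serves as [v]. This gives two adjacent selected vertices
    the common neighbour that the Ore condition gives non-adjacent ones. *)
Definition low_deg_nbr H :=
  2 < #|V| -> exists v, {in H, forall x, dg x H <= 1 -> e x v}.

(** Vacuous: a vertex of degree at most 1 has a non-neighbour, whose degree is at most
    [#|V| - 2]. *)
Lemma low_deg_nbrT : low_deg_nbr setT.
Proof.
move=> V3; have /card_gt0P[v _] : 0 < #|V| by apply: leq_trans V3.
exists v => x _; rewrite dg_setT => dx.
have [y] : exists y, y \in ~: (x |: nbr e x).
  apply/card_gt0P; rewrite cardsCs setCK cardsU1 !inE; case: (~~ _); lia.
rewrite !inE negb_or => /andP[nyx nxy].
have := e_ore (u := x) (v := y); rewrite eq_sym nyx nxy => /(_ isT isT).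
have := @dg_lt y (~: [set x]); rewrite !inE nyx => /(_ isT).
have := dg_split_deg y [set x]; rewrite dg_sum big_set1 e_sym (negbTE nxy) add0n => ->.
by have := cardsC [set x]; rewrite cards1; lia.
Qed.

Lemma low_deg_nbr_step H v : v \in H -> {in H, forall x, 1 < dg x H} ->
  low_deg_nbr (H :\ v).
Proof.
move=> vH dH _; exists v => x /setD1P[_ xH].
by have := dH x xH; rewrite (dgD1 x vH); case: (e x v) => //; lia.
Qed.

(** * Pairs contained in no proper closed set *)

(** Both neighbourhoods avoid [x] and [y], so their union has at most [#|V| - 2] vertices. *)
Lemma nonadjacent_common_nbrs x y : x != y -> ~~ e x y ->
  1 < #|nbr e x :&: nbr e y|.
Proof.
move=> nxy exy; have := e_ore nxy exy; rewrite -cardsUI.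
suff: #|nbr e x :|: nbr e y| + 2 <= #|V| by lia.
rewrite -(cardsC [set x; y]) cards2 nxy addnC leq_add2l.
apply/subset_leq_card/subsetP => z; rewrite !inE negb_or.
case: (eqVneq z x) => [->|nzx]; first by rewrite e_irr e_sym (negbTE exy).
by case: (eqVneq z y) => [->|//]; rewrite e_irr (negbTE exy).
Qed.

Lemma closed_common_nbrs A x y : closed A -> x != y -> x \in A -> y \in A ->
  nbr e x :&: nbr e y \subset A.
Proof.
move=> clA nxy xA yA; apply/subsetP => z /[!inE] /andP[xz yz].
apply: contraT => zA; have := clA z zA; rewrite (dgD1 z xA) (@dgD1 z y).
  by rewrite ![e z _]e_sym xz yz.
by rewrite !inE eq_sym nxy.
Qed.

Lemma pair_generates H u w : deletion_inv H -> low_deg_nbr H ->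
  u \in H -> w \in H -> u != w -> dg u H <= 1 -> (e u w -> dg w H <= 1) ->
  forall A, closed A -> u \in A -> w \in A -> A = setT.
Proof.
move=> invH lowH uH wH nuw du dw A clA uA wA.
apply/eqP; apply: contraT => AT.
have suwA : [set u; w] \subset A by rewrite subUset !sub1set uA wA.
have comA := closed_common_nbrs clA nuw uA wA.
have A3 : 2 < #|A|.
  have [z /setIP[uz wz]] : exists z, z \in nbr e u :&: nbr e w.
    have [uw|uw] := boolP (e u w); last first.
      by apply/card_gt0P; apply: ltnW; apply: nonadjacent_common_nbrs.
    have [|v vP] := lowH.
      have := proper_card (_ : A \proper setT); rewrite properT AT cardsT.
      by move=> /(_ isT); have := subset_leq_card suwA; rewrite cards2 nuw; lia.
    by exists v; rewrite !inE !vP // dw.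
  have zA : z \in A by apply: (subsetP comA); rewrite inE uz.
  have : [set u; w] \proper A.
    apply/properP; split=> //; exists z => //; rewrite !inE negb_or.
    by move: uz wz; rewrite !inE; case: eqVneq => [->|_]; rewrite ?e_irr //;
       case: eqVneq => [->|_]; rewrite ?e_irr.
  by move/proper_card; rewrite cards2 nuw.
have B2 : 1 < #|A :&: H|.
  have := @subset_leq_card _ [set u; w] (A :&: H); rewrite cards2 nuw; apply.
  by rewrite subUset !sub1set !inE uA uH wA wH.
have [sCH|[cA cC [y [z [/setIP[yA yH] /setDP[zH zA] yz]]]]] := invH A clA A3 AT B2.
  (* [u] has degree at least [#|A|], while at most [#|A| - 2] of its neighbours are outside [H]. *)
  have := deg_ge_card clA AT (ltnW A3) uA; rewrite (dg_split_deg u H).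
  have := dg_le u (~: H); have := cardsID H A.
  suff -> : A :\: H = ~: H by move: du B2; clear; lia.
  apply/setP => x; rewrite !inE; case xH: (x \in H) => //=.
  by apply: contraFT xH => xA; apply: (subsetP sCH); rewrite inE.
(* In [H], [u] and [w] have only each other as neighbours; yet [y] is one of them, with the further
   neighbour [z], or a third vertex of the clique. *)
have uw : e u w by apply: cA.
have {}dw := dw uw.
have two a b : e a b -> b \in A -> b \in H -> e a z -> dg a H <= 1 -> False.
  move=> ab bA bH az; rewrite (dgD1 a bH) (@dgD1 a z) ?ab ?az //.
  by rewrite !inE zH andbT; apply: contraNneq zA => ->.
have [yu|nyu] := eqVneq y u; first by apply: False_ind; apply: (two u w); rewrite -?yu // yu.
have [yw|nyw] := eqVneq y w.
  by apply: False_ind; apply: (two w u); rewrite // -?yw // yw e_sym.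
move: du; rewrite (dgD1 u wH) uw (@dgD1 u y) ?cA 1?eq_sym //.
by rewrite !inE nyw.
Qed.

End ClosedSets.

(** * Activation and target sets *)

Section Algorithm.
Variables (V : finType) (e : rel V).
Hypotheses (e_sym : symmetric e) (e_irr : irreflexive e) (e_ore : ore_graph e).
Local Notation t2 := (fun _ : V => 2).
Local Notation state := (mts_state V).
Local Notation dg := (dg e).
Implicit Types (A H L S T U : {set V}) (s : state) (u v w x : V).

Lemma in_nbrE x : in_nbr e x = nbr e x.
Proof. by apply/setP => y; rewrite !inE e_sym. Qed.

(** Every round that changes the set adds a vertex, so [l > #|V|] forces a fixed point. *)
Lemma activated_leq_stable S l :
  (exists j, activated e t2 S j.+1 = activated e t2 S j) \/
  l <= #|activated e t2 S l|.
Proof.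
elim: l => [|l [|IH]]; [by right|by left|].
have [st|nst] := eqVneq (activated e t2 S l.+1) (activated e t2 S l).
  by left; exists l.
right; apply: leq_ltn_trans IH _; apply: proper_card.
by rewrite properEneq eq_sym nst /= subsetUl.
Qed.

Lemma sub_activated S l : S \subset activated e t2 S l.
Proof. by elim: l => //= l IH; apply: subset_trans IH (subsetUl _ _). Qed.

Lemma closed_target_set S :
  (forall A, closed e A -> S \subset A -> A = setT) -> target_set e t2 S.
Proof.
move=> gen; have [[j stable]|] := activated_leq_stable S #|V|.+1; last first.
  by rewrite leqNgt ltnS max_card.
exists j; apply: gen (sub_activated S j) => x xA.
rewrite leqNgt; apply: contra xA => dx; rewrite -stable /= !inE in_nbrE.
by apply/orP; right.
Qed.

Lemma target_set_small T : target_set e t2 T -> #|T| <= 1 -> T = setT.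
Proof.
move=> [l] + T1; suff -> : activated e t2 T l = T by [].
elim: l => //= l ->; apply/setUidPl/subsetP => x.
rewrite inE => /leq_trans/(_ (subset_leq_card (subsetIr _ _))); lia.
Qed.

Lemma min_target_set_le2 S : #|S| <= 2 ->
  (forall A, closed e A -> S \subset A -> A = setT) -> min_target_set e t2 S.
Proof.
move=> S2 gen; split=> [|T tT]; first exact: closed_target_set.
have [T1|T2] := leqP #|T| 1; last exact: leq_trans T2.
by rewrite (target_set_small tT T1) cardsT max_card.
Qed.

(** * Counters of MTS in terms of degrees *)

Lemma mts_ratio_le s u v : 0 < st_delta s u -> 0 < st_delta s v ->
  (mts_ratio s u <= mts_ratio s v)%R =
  (st_k s u * (st_delta s v * (st_delta s v).+1) <=
   st_k s v * (st_delta s u * (st_delta s u).+1)).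
Proof.
move=> du dv; rewrite /mts_ratio ler_pdivrMr ?ltr0n ?muln_gt0 ?du //.
rewrite mulrAC ler_pdivlMr ?ltr0n ?muln_gt0 ?dv //.
by rewrite -!natrM ler_nat.
Qed.

Definition cand s := st_U s :\: st_L s.

(** Truncated subtraction mirrors the cut-off at 0. A node of [L] was discounted from [st_delta] on
    entering [L], not on leaving [U]. *)
Definition counters s := {in st_U s, forall x,
  st_k s x = 2 - dg x (~: st_U s) /\ st_delta s x = dg x (cand s)}.

Lemma counters_init : counters (mts_init e t2).
Proof.
by move=> x _ /=; rewrite /cand /= setD0 dg_setT in_nbrE setCT dg_set0.
Qed.

Lemma dec_on_nbr (f : V -> nat) v U x : x \in U ->
  dec_on (out_nbr e v :&: U) f x = f x - e x v.
Proof.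
by move=> xU; rewrite /dec_on !inE xU andbT e_sym; case: (e x v); rewrite ?subn1 ?subn0.
Qed.

Lemma dg_setCD1 x v U : v \in U -> dg x (~: (U :\ v)) = e x v + dg x (~: U).
Proof.
move=> vU; rewrite (@dgD1 _ _ x v) ?inE ?eqxx //; congr (_ + dg _ _).
by apply/setP => y; rewrite !inE; case: eqVneq => // ->; rewrite vU.
Qed.

Lemma setDD1 U L v : (U :\ v) :\: L = (U :\: L) :\ v.
Proof. by apply/setP => y; rewrite !inE; case: (y == v); rewrite ?andbF. Qed.

Lemma counters_step s s' : mts_step e s s' -> counters s -> counters s'.
Proof.
move=> st cs; case: st => [v|v _|v _ _ [vU _]] /=.
- move=> /andP[vU _] x /= /setD1P[nxv xU]; have [kx dx] := cs x xU.
  rewrite dec_on_nbr // kx dg_setCD1 // /cand /= setDD1; split; first lia.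
  case: ifP => vL.
    rewrite dx /cand (_ : _ :\ v = st_U s :\: st_L s) //; apply/setP => y.
    by rewrite !inE; case: eqVneq => // ->; rewrite vL.
  by rewrite dec_on_nbr // dx /cand (@dgD1 _ _ x v) ?inE ?vL ?vU // addKn.
- move=> /andP[/setDP[vU vL] _] x /= /setD1P[nxv xU]; have [kx dx] := cs x xU.
  rewrite !dec_on_nbr // kx dg_setCD1 // /cand /= setDD1; split; first lia.
  by rewrite dx /cand (@dgD1 _ _ x v) ?inE ?vL ?vU // addKn.
move=> x /= xU; have [kx dx] := cs x xU; split=> //.
rewrite dec_on_nbr // dx /cand /= (dgD1 _ x vU) addKn; congr (dg _ _).
by apply/setP => y; rewrite !inE negb_or; case: (y == v).
Qed.

(** * Phases of an execution *)

(* The phases are indexed by the size of the output, phase 2 being entered at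
   the second selection. *)
Record phase0 s : Prop := Phase0 {
  p0_S : st_S s = set0;
  p0_U : st_U s = setT;
  p0_inv : deletion_inv e (cand s);
  p0_low : low_deg_nbr e (cand s);
  p0_cand : st_L s = set0 \/ 1 < #|cand s| }.

(* [H] is the value of [cand] when [u] was selected. *)
Record phase1 s u H : Prop := Phase1 {
  p1_S : st_S s = [set u];
  p1_U : st_U s = ~: [set u];
  p1_inv : deletion_inv e H;
  p1_low : low_deg_nbr e H;
  p1_uH : u \in H;
  p1_du : dg u H <= 1;
  p1_sub : cand s \subset H;
  p1_nbr : {in cand s, forall w, e u w -> dg w (cand s) = 0 -> dg w H <= 1};
  p1_cand : cand s = set0 -> st_U s = set0 }.

Record phase2 s : Prop := Phase2 {
  p2_card : #|st_S s| <= 2;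
  p2_S : st_S s \subset ~: st_U s;
  p2_gen : forall A, closed e A -> st_S s \subset A -> A = setT }.

Inductive phase s : Prop :=
| InPhase0 of phase0 s
| InPhase1 u H of phase1 s u H
| InPhase2 of phase2 s.

Lemma phase0_k s x : counters s -> phase0 s -> st_k s x = 2.
Proof.
move=> cs [_ UT _ _ _]; have [|-> _] := cs x; first by rewrite UT inE.
by rewrite UT setCT dg_set0.
Qed.

Lemma phase1_k s u H x : counters s -> phase1 s u H -> x != u ->
  st_k s x = 2 - e u x.
Proof.
move=> cs ph nxu; have UE := p1_U ph.
have [|-> _] := cs x; first by rewrite UE !inE.
by rewrite UE setCK dg_sum big_set1 e_sym.
Qed.

Lemma case1_closed s : counters s -> (forall w, ~~ case1_node s w) ->
  closed e (~: st_U s).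
Proof.
move=> cs no1 x; rewrite inE negbK => xU; have [kx _] := cs x xU.
by have := no1 x; rewrite /case1_node xU kx /=; lia.
Qed.

Lemma case2_delta s x : (forall w, ~~ case2_node s w) -> counters s ->
  x \in cand s -> st_k s x <= dg x (cand s).
Proof.
move=> no2 cs xc; have xU : x \in st_U s by case/setDP: xc.
by have := no2 x; rewrite /case2_node xc /= -leqNgt; have [_ ->] := cs x xU.
Qed.

Lemma phase0_step s s' : counters s -> phase0 s -> mts_step e s s' -> phase s'.
Proof.
move=> cs ph st; have k2 x := phase0_k x cs ph.
have xU x : x \in st_U s by rewrite (p0_U ph) inE.
have dE x : st_delta s x = dg x (cand s) by have [] := cs x (xU x).
case: st => [v|v _|v _ no2 [vc vmax]] /=.
- by rewrite /case1_node k2 andbF.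
- rewrite /case2_node k2 dE ltnS -/(cand s) => /andP[vc dv].
  apply: (@InPhase1 _ v (cand s)); split=> //=.
  + by rewrite (p0_S ph) setU0.
  + by rewrite (p0_U ph) setTD.
  + exact: p0_inv.
  + exact: p0_low.
  + by rewrite /cand /= setDD1 subD1set.
  + by move=> w; rewrite /cand /= setDD1 => _ vw; rewrite (dgD1 _ w vc) => ->;
       rewrite addn0 leq_b1.
  (* If [cand] runs empty here, [L] is empty, so [cand] and [U] coincide. *)
  rewrite /cand /= setDD1 -/(cand s) => c0; have [L0|] := p0_cand ph.
    by move: c0; rewrite /cand L0 setD0.
  by rewrite (cardsD1 v) vc c0 cards0.
have dc : {in cand s, forall x, 1 < dg x (cand s)}.
  by move=> x xc; have := case2_delta no2 cs xc; rewrite k2.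
(* All [k] equal 2, so the largest ratio belongs to the smallest degree. *)
have vmin : {in cand s, forall x, dg v (cand s) <= dg x (cand s)}.
  move=> x xc; have := vmax x xc.
  rewrite mts_ratio_le ?dE ?(ltnW (dc _ _)) // !k2.
  by have := dc x xc; have := dc v vc; clear; nia.
have cE : st_U s :\: (v |: st_L s) = cand s :\ v.
  by apply/setP => y; rewrite !inE negb_or -andbA.
apply: InPhase0; split; rewrite /cand /= ?cE; try by case: ph.
- exact: deletion_inv_step (p0_inv ph).
- exact: low_deg_nbr_step.
right; rewrite -/(cand s) in vc; have := leq_ltn_trans (dc v vc) (dg_lt e_irr vc).
by rewrite (cardsD1 v) vc.
Qed.

(** [u] is the only node outside [U], so Case 1 never applies. In Case 3, a neighbour of [u] about
    to lose [v] as its last candidate neighbour would beat [v] in ratio, because [v] is then not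
    adjacent to [u]. *)
Lemma phase1_step s s' u H : counters s -> phase1 s u H -> mts_step e s s' ->
  phase s'.
Proof.
move=> cs ph st; have k2 x := phase1_k cs ph (x := x).
have UE := p1_U ph; have sub := subsetP (p1_sub ph).
have cU x : x \in cand s -> x != u.
  by rewrite !inE UE !inE => /andP[_].
have dE x : x \in cand s -> st_delta s x = dg x (cand s).
  by move=> /setDP[xU _]; have [] := cs x xU.
case: st => [v|v _|v _ no2 [vc vmax]] /=.
- by rewrite /case1_node UE !inE => /andP[nvu]; rewrite k2 //; case: (e u v).
- move=> /andP[vc]; rewrite -/(cand s) in vc; rewrite dE // k2 ?cU // => dv.
  apply: InPhase2; split=> /=.
  + by rewrite (p1_S ph) cards2 ltnS leq_b1.
  + by rewrite (p1_S ph) UE; apply/subsetP => x; rewrite !inE;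
       case: (x == v); case: (x == u).
  move=> A clA; rewrite (p1_S ph) subUset !sub1set => /andP[vA uA].
  apply: (pair_generates e_sym e_irr e_ore (p1_inv ph) (p1_low ph) (p1_uH ph)
           (sub v vc) _ (p1_du ph)) => //.
    by rewrite eq_sym cU.
  (* A neighbour [v] of [u] has [k = 1], so Case 2 means that it is isolated in [cand s]. *)
  move=> uv; apply: (p1_nbr ph) => //; by move: dv; rewrite uv; case: (dg _ _).
have cE : st_U s :\: (v |: st_L s) = cand s :\ v.
  by apply/setP => y; rewrite !inE negb_or -andbA.
have vgt0 : 0 < dg v (cand s).
  have := case2_delta no2 cs vc; rewrite k2 ?cU //; case: (e u v); lia.
apply: (@InPhase1 _ u H); split; rewrite /cand /= ?cE; try by case: ph.
- exact: subset_trans (subD1set _ _) (p1_sub ph).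
- move=> w /setD1P[nwv wc] uw dw.
  have [|dw0] := posnP (dg w (cand s)); first exact: (p1_nbr ph).
  have {dw} dw1 : dg w (cand s) = 1.
    by move: dw0; rewrite (dgD1 _ w vc) dw; case: (e w v).
  have nuv : e u v = false.
    apply/negP => uv; have := p1_du ph; rewrite (dgD1 _ u (sub w wc)).
    by rewrite (@dgD1 _ _ u v) ?inE ?sub ?uw ?uv // eq_sym nwv.
  have := case2_delta no2 cs vc; rewrite k2 ?cU // nuv => dv.
  (* Here [w] has ratio 1/2, while [v] has threshold 2, hence ratio at most 1/3. *)
  have := vmax w wc; rewrite mts_ratio_le ?dE ?dw1 // !k2 ?cU // uw nuv.
  by move: dv; clear; nia.
move=> c0; have := dg_lt e_irr vc; rewrite (cardsD1 v) vc c0 cards0 ltnS.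
by rewrite leqNgt vgt0.
Qed.

(** In Case 2 the removed nodes would form a closed set containing the output, hence all of [V],
    leaving no node to select. *)
Lemma phase2_step s s' : counters s -> phase2 s -> mts_step e s s' -> phase2 s'.
Proof.
move=> cs [S2 SU gen]; case=> [v|v no1|v _ _ _] /=.
- move=> _; split=> //=; apply: subset_trans SU _.
  by rewrite setCS subD1set.
- move=> /andP[/setDP[vU _] _].
  by have /setP/(_ v) := gen _ (case1_closed cs no1) SU; rewrite !inE vU.
by split.
Qed.

Lemma phase_init : phase (mts_init e t2).
Proof.
apply: InPhase0; split; rewrite /cand ?setD0 //=; last by left.
  by apply: deletion_invT.
exact: low_deg_nbrT.
Qed.

Lemma reachable_phase s :
  clos_refl_trans state (mts_step e) (mts_init e t2) s -> counters s /\ phase s.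
Proof.
have : counters (mts_init e t2) /\ phase (mts_init e t2).
  by split; [exact: counters_init | exact: phase_init].
move: (mts_init e t2) => s0 + st; elim: st => {s0 s} //.
  move=> s s' st [cs ph]; split; first exact: counters_step cs.
  case: ph => [ph|u H ph|ph]; [exact: phase0_step ph st|exact: phase1_step ph st|].
  by apply: InPhase2; apply: phase2_step ph st.
by move=> s1 s2 s3 _ IH1 _ IH2 /IH1/IH2.
Qed.

(** * Progress and termination *)

(** This keeps Case 3 from lacking a node to choose. *)
Lemma cand_nonempty s : counters s -> phase s ->
  (forall w, ~~ case1_node s w) -> cand s = set0 -> st_U s = set0.
Proof.
move=> cs ph no1; case: ph => [ph|u H ph|[S2 SU gen]] c0; last 1 first.
- by have := gen _ (case1_closed cs no1) SU; move/(canRL setCK); rewrite setCT.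
- have [L0|] := p0_cand ph; last by rewrite c0 cards0.
  by move: c0; rewrite /cand L0 setD0.
exact: (p1_cand ph).
Qed.

Lemma stuck_empty s : counters s -> phase s -> (forall s', ~ mts_step e s s') ->
  st_U s = set0.
Proof.
move=> cs ph stuck.
have no1 w : ~~ case1_node s w.
  by apply/negP => c1; apply: stuck (MtsCase1 e c1).
have no2 w : ~~ case2_node s w.
  by apply/negP => c2; apply: stuck (MtsCase2 e no1 c2).
apply: (cand_nonempty cs ph no1).
apply/eqP; apply: contraT => /set0Pn[x xc].
have := @Order.TotalTheory.arg_maxP _ _ _ x (mem (cand s)) (mts_ratio s) xc.
case=> v vc vmax; have c3 : case3_node s v by split.
by case: (stuck _ (MtsCase3 e no1 no2 c3)).
Qed.

(** Cases 1 and 2 shrink [U]; Case 3 shrinks the candidates. *)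
Lemma mts_step_measure s s' : mts_step e s s' ->
  #|st_U s'| + #|cand s'| < #|st_U s| + #|cand s|.
Proof.
case=> [v|v _|v _ _ [vc _]] /=; rewrite /cand /=.
- move=> /andP[vU _]; rewrite setDD1 (cardsD1 v (st_U s)) vU ltnS leq_add2l.
  exact/subset_leq_card/subD1set.
- move=> /andP[/setDP[vU _] _]; rewrite setDD1 (cardsD1 v (st_U s)) vU ltnS leq_add2l.
  exact/subset_leq_card/subD1set.
rewrite ltn_add2l; apply: proper_card; apply/properP; split.
  by rewrite setDS ?subsetUr.
by exists v; rewrite // !inE eqxx.
Qed.

Lemma mts_terminates (f : nat -> state) : ~ forall i, mts_step e (f i) (f i.+1).
Proof.
move=> st; pose m i := #|st_U (f i)| + #|cand (f i)|.
have dec i : m i + i <= m 0.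
  elim: i => [|i]; first by rewrite addn0.
  by apply: leq_trans; rewrite addnS -addSn leq_add2r mts_step_measure.
by have := dec (m 0).+1; rewrite addnS; clear; lia.
Qed.

End Algorithm.

Theorem theorem4 (V : finType) (e : rel V)
    (e_sym : symmetric e) (e_irr : irreflexive e) (e_ore : ore_graph e) :
  mts_always_returns e (fun _ : V => 2) (min_target_set e (fun _ : V => 2)).
Proof.
split=> [[f [_ /mts_terminates]]//|s reach stuck].
have [cs ph] := reachable_phase e_sym e_irr e_ore reach.
have U0 := stuck_empty cs ph stuck.
split=> //; apply: min_target_set_le2 => //.
  case: ph => [ph|u H ph|[]//]; first by rewrite (p0_S ph) cards0.
  by rewrite (p1_S ph) cards1.
(* With [U] empty, phase 0 means that [V] is empty, and phase 1 that [u] is its only node. *)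
case: ph => [ph|u H ph|[]//] A _ SA.
  by apply/eqP; rewrite -subTset -(p0_U ph) U0 sub0set.
apply/eqP; rewrite -subTset; apply/subsetP => x _; apply: (subsetP SA).
have := p1_U ph; rewrite U0 (p1_S ph) => /setP/(_ x).
by rewrite !inE => /esym/negbFE.
Qed.
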